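(* Let $\mathfrak{n}_0=U\oplus\mathfrak{g}_0$ be the real 2-step nilpotent metric Lie algebra with Chevalley rational structure $\mathfrak{n}_{0,\mathbb{Q}}$ described in the context. For $\lambda\in\Lambda\subset\mathrm{Hom}(\mathfrak{h},\mathbb{C})$ let $\mathfrak{n}_0(\lambda)=U_\lambda\oplus\mathbb{R}\tilde H_\lambda$. If $2\lambda\notin\Phi$, then $\mathfrak{n}_0(\lambda)$ is a totally geodesic subalgebra of $\mathfrak{n}_0$ with a 1-dimensional center that is rational with respect to the Chevalley rational structure $\mathfrak{n}_{0,\mathbb{Q}}$ on $\mathfrak{n}_0$ (i.e. $\mathfrak{n}_0(\lambda)$ has a basis contained in $\mathfrak{n}_{0,\mathbb{Q}}$).
   Context: $\mathfrak{g}_0$ is a compact semisimple real Lie algebra with Killing form $B_0$ (negative definite), $U$ a finite dimensional real $\mathfrak{g}_0$-module, $\mathfrak{h}_0$ a maximal abelian subalgebra of $\mathfrak{g}_0$, $\mathfrak{h}=\mathfrak{h}_0^{\mathbb{C}}$, $\mathfrak{g}=\mathfrak{g}_0^{\mathbb{C}}$, $V=U^{\mathbb{C}}$; $\Phi$ are the roots of $\mathfrak{h}$ with base $\Delta$ and positive roots $\Phi^+$, $\Lambda$ the nonzero weights of $V$; $V_\lambda=\{v\in V:Hv=\lambda(H)v\ \forall H\in\mathfrak{h}\}$, $U_\lambda=(V_\lambda\oplus V_{-\lambda})\cap U$, $U_0=V_0\cap U$. Compact Chevalley basis: $\tau_\alpha=2H_\alpha/B(H_\alpha,H_\alpha)$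 with $B$ the Killing form of $\mathfrak{g}$, $B(H,H_\alpha)=\alpha(H)$. Let $\{X_\beta:\beta\in\Phi;\tau_\alpha:\alpha\in\Delta\}$ be a basis of $\mathfrak{g}$ with $X_\beta\in\mathfrak{g}_\beta$, $[X_\alpha,X_{-\alpha}]=\tau_\alpha$, $[X_\alpha,X_\beta]=C_{\alpha,\beta}X_{\alpha+\beta}$ with $C_{\alpha,\beta}=-C_{-\alpha,-\beta}$ whenever $\alpha,\beta,\alpha+\beta\in\Phi$, such that $\mathfrak{C}_0=\{\tilde\tau_\alpha=i\tau_\alpha:\alpha\in\Delta;\ X_\beta-X_{-\beta},\ iX_\beta+iX_{-\beta}:\beta\in\Phi^+\}$ is an $\mathbb{R}$-basis of $\mathfrak{g}_0$. $\mathfrak{B}_0$ is a basis of $U$ such that $\mathfrak{C}_0$ leaves $\mathbb{Q}\text{-span}(\mathfrak{B}_0)$ invariant and $\mathfrak{B}_0$ is a union of bases of the subspaces $U_0$ and $U_\mu$, $\mu\in\Lambda$. The Chevalley rational structure is $\mathfrak{n}_{0,\mathbb{Q}}=\mathbb{Q}\text{-span}(\mathfrak{B}_0\cup\mathfrak{C}_0)$. $\langle\,,\rangle$ is an inner product on $\mathfrak{n}_0$ such that $U\perp\mathfrak{g}_0$, every $X\in\mathfrak{g}_0$ is skew symmetric on $U$, $\langle\,,\rangle=-B_0$ on $\mathfrak{g}_0$, and $\langle\xi,\xi'\rangle\in\mathbb{Q}$ for all $\xi,\xi'\in\mathfrak{B}_0\cup\mathfrak{C}_0$. The bracket on $\mathfrak{n}_0$: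 $\mathfrak{g}_0$ is central, $[\mathfrak{n}_0,\mathfrak{n}_0]\subseteq\mathfrak{g}_0$, $\langle[u,u'],Z\rangle=\langle Z(u),u'\rangle$ for $u,u'\in U$, $Z\in\mathfrak{g}_0$. $\tilde H_\lambda\in\mathfrak{h}_0$ is the unique vector with $\langle\tilde H,\tilde H_\lambda\rangle=-i\lambda(\tilde H)$ for all $\tilde H\in\mathfrak{h}_0$. Let $N_0$ be the simply connected Lie group with Lie algebra $\mathfrak{n}_0$ and the left invariant metric determined by $\langle\,,\rangle$. A subalgebra $\mathfrak{n}_0^*$ is totally geodesic if the subgroup $\exp(\mathfrak{n}_0^* )$ is a totally geodesic submanifold of $N_0$; equivalently $\nabla_XY\in\mathfrak{n}_0^*$ for all $X,Y\in\mathfrak{n}_0^*$, with $\nabla$ the Levi-Civita connection on left invariant fields. *)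

(* Defs.v *)
From HB Require Import structures.
From mathcomp Require Import all_boot all_order all_algebra.
From mathcomp Require Import complex.
From mathcomp Require Import boolp classical_sets reals.

Set Implicit Arguments.
Unset Strict Implicit.
Unset Printing Implicit Defensive.

Import Order.TTheory GRing.Theory Num.Theory.
Local Open Scope classical_set_scope.
Local Open Scope ring_scope.

(* The complexification of a real vector space V, with (x, y) standing for
   x + i y; it is a separate type so that its R[i]-module structure is not
   confused with the R-module structure of the product V * V. *)

Definition cplx (R : realType) (V : vectType R) : Type := (V * V)%type.

Section Complexification.
Import VectorInternalTheory.
Variables (R : realType) (V : vectType R).

HB.instance Definition _ := GRing.Zmodule.on (cplx V).

Definition cscale (c : R[i]) (x : cplx V) : cplx V :=
  (complex.Re c *: x.1 - complex.Im c *: x.2,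
   complex.Re c *: x.2 + complex.Im c *: x.1).

Lemma cscaleA a b x : cscale a (cscale b x) = cscale (a * b) x.
Proof.
case: a b x => [a1 a2] [b1 b2] [x y]; congr pair => /=.
- rewrite scalerBl scalerBr scalerDr scalerDl !scalerA !opprD -!addrA.
  by congr (_ + _); rewrite [LHS]addrA [LHS]addrC.
- rewrite scalerDr scalerBr scalerBl scalerDl !scalerA -!addrA.
  by congr (_ + _); rewrite [LHS]addrA [LHS]addrC.
Qed.

Lemma cscale1 : left_id 1 cscale.
Proof. by case=> x y; rewrite /cscale /= !scale1r !scale0r subr0 addr0. Qed.

Lemma cscaleDr : right_distributive cscale +%R.
Proof.
move=> [a b] [x y] [z t]; congr pair => /=.
- by rewrite !scalerDr opprD addrACA.
- by rewrite !scalerDr addrACA.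
Qed.

Lemma cscaleDl x : {morph cscale^~ x : a b / a + b}.
Proof.
case: x => x y [a b] [c d]; congr pair => /=.
- by rewrite !scalerDl opprD addrACA.
- by rewrite !scalerDl addrACA.
Qed.

HB.instance Definition _ := GRing.Zmodule_isLmodule.Build R[i] (cplx V)
  cscaleA cscale1 cscaleDr cscaleDl.

Lemma cplx_vect_iso : Vector.axiom (dim V) (cplx V).
Proof.
pose f (x : cplx V) : 'rV[R[i]]_(dim V) :=
  \row_j (v2r x.1 0 j +i* v2r x.2 0 j)%C.
pose g (r : 'rV[R[i]]_(dim V)) : cplx V :=
  (r2v (\row_j complex.Re (r 0 j)), r2v (\row_j complex.Im (r 0 j))).
exists f.
- move=> [a b] [x y] [z t]; apply/rowP => j.
  have -> : (a +i* b)%C *: ((x, y) : cplx V) + ((z, t) : cplx V) =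
      (a *: x - b *: y + z, a *: y + b *: x + t) :> cplx V by [].
  by rewrite !mxE /= !(linearD, linearN, linearZ) /= !mxE mulrN.
- exists g => [[x y]|r].
  + by congr pair; apply: (canLR v2rK); apply/rowP => j; rewrite !mxE.
  + by apply/rowP => j; rewrite !mxE /= !r2vK !mxE; case: (r 0 j).
Qed.

HB.instance Definition _ :=
  Lmodule_hasFinDim.Build R[i] (cplx V) cplx_vect_iso.

Definition to_cplx (x : V) : cplx V := (x, 0).

Definition cplx_vs (W : {vspace V}) : {vspace cplx V} :=
  <<[seq to_cplx x | x <- vbasis W]>>%VS.

Lemma mem_cplx_vs (W : {vspace V}) (x : cplx V) :
  (x \in cplx_vs W) = (x.1 \in W) && (x.2 \in W).
Proof.
have sW w : w \in W -> to_cplx w \in cplx_vs W.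
  move=> Ww; rewrite (coord_vbasis Ww).
  have -> (n : nat) (c : 'I_n -> R) (e : 'I_n -> V) :
      to_cplx (\sum_i c i *: e i) = \sum_i (c i)%:C%C *: to_cplx (e i).
    apply: (big_ind2 (fun u (v : cplx V) => to_cplx u = v)) => //.
      by move=> u _ v _ <- <-; congr pair; rewrite /= addr0.
    by move=> i _; congr pair; rewrite /= scale0r ?scaler0 ?subr0 ?addr0.
  apply: rpred_sum => i _; apply/rpredZ/memv_span/map_f/mem_nth.
  by rewrite size_tuple.
apply/idP/andP => [|[W1 W2]].
- move/coord_span=> ->; elim/big_rec: _ => [|i y _ [W1 W2]].
    by rewrite !mem0v.
  set e := _`_i; have [w Ww ->] : exists2 w, w \in W & e = to_cplx w.
    have /mapP[w /vbasis_mem Ww ->] : e \in [seq to_cplx x | x <- vbasis W].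
      by apply: mem_nth; rewrite size_tuple.
    by exists w.
  by rewrite /= !scaler0 subr0 add0r; split; apply: rpredD => //; apply: rpredZ.
- have -> : x = to_cplx x.1 + 'i%C *: to_cplx x.2.
    case: (x) => u v; congr pair => /=.
    + by rewrite scale0r scaler0 subrr addr0.
    + by rewrite scale0r scale1r !add0r.
  by apply: rpredD; [exact: sW | apply/rpredZ/sW].
Qed.

End Complexification.

(* The R[i]-bilinear extension of a bilinear map. *)
Definition cplx_bil (R : realType) (V1 V2 V3 : vectType R)
    (f : V1 -> V2 -> V3) (x : cplx V1) (y : cplx V2) : cplx V3 :=
  (f x.1 y.1 - f x.2 y.2, f x.1 y.2 + f x.2 y.1).

Section LieAlgebra.
Variables (F : fieldType) (L : vectType F) (br : L -> L -> L).

Definition bilinear_map (V1 V2 V3 : lmodType F) (f : V1 -> V2 -> V3) : Prop :=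
  (forall x, linear (f x)) /\ (forall y, linear (f^~ y)).

Definition is_lie_bracket : Prop :=
  [/\ bilinear_map br,
      forall x, br x x = 0 &
      forall x y z, br x (br y z) + br y (br z x) + br z (br x y) = 0].

Definition is_lie_action (U : vectType F) (act : L -> U -> U) : Prop :=
  bilinear_map act /\
  forall x y u, act (br x y) u = act x (act y u) - act y (act x u).

Definition lie_killing (x y : L) : F :=
  \sum_(i < \dim {:L})
    coord (vbasis {:L}) i (br x (br y (vbasis {:L})`_i)).

Definition abelian_subspace (W : {vspace L}) : Prop :=
  forall x y, x \in W -> y \in W -> br x y = 0.

Definition maximal_abelian (W : {vspace L}) : Prop :=
  abelian_subspace W /\
  forall W' : {vspace L}, (W <= W')%VS -> abelian_subspace W' -> W' = W.

Definition has_basis (S : set L) (X : seq L) : Prop :=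
  free X /\ S = [set x | x \in <<X>>%VS].

Definition has_dim (S : set L) (d : nat) : Prop :=
  exists W : {vspace L}, S = [set x | x \in W] /\ \dim W = d.

Definition is_subalgebra (S : set L) : Prop :=
  (exists W : {vspace L}, S = [set x | x \in W]) /\
  forall x y, S x -> S y -> S (br x y).

Definition lie_center (S : set L) : set L :=
  [set x | S x /\ forall y, S y -> br x y = 0].

End LieAlgebra.

Section MetricLieAlgebra.
Variables (R : realType) (L : vectType R).
Variables (br : L -> L -> L) (ip : L -> L -> R).

Definition is_inner_product : Prop :=
  [/\ forall x y, ip x y = ip y x,
      forall x, scalar (ip x) &
      forall x, x != 0 -> 0 < ip x x].

(* The Levi-Civita connection restricted to left invariant fields: functions
   ip X Y are constant, so metric compatibility has no derivative term. *)
Definition is_levi_civita (nabla : L -> L -> L) : Prop :=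
  [/\ bilinear_map nabla,
      forall x y, nabla x y - nabla y x = br x y &
      forall x y z, ip (nabla x y) z + ip y (nabla x z) = 0].

Definition totally_geodesic (nabla : L -> L -> L) (S : set L) : Prop :=
  forall x y, S x -> S y -> S (nabla x y).

Definition Qspan (s : seq L) : set L :=
  [set x | exists q : 'I_(size s) -> rat,
    x = \sum_(i < size s) ratr (q i) *: s`_i].

End MetricLieAlgebra.

Section Weights.
Variables (R : realType) (g0 : vectType R) (h0 : {vspace g0}).

Definition hdual : vectType R[i] := 'Hom(subvs_of (cplx_vs h0), R[i]^o).

(* The value of mu at H; meaningful for H in the complexification of h0. *)
Definition heval (mu : hdual) (H : cplx g0) : R[i] :=
  (mu : 'Hom(_, _)) (vsproj (cplx_vs h0) H).

Section Module.
Variables (V : vectType R) (act : g0 -> V -> V).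

Definition weight_space (mu : hdual) : set (cplx V) :=
  [set v | forall H, H \in cplx_vs h0 -> cplx_bil act H v = heval mu H *: v].

Definition nonzero_weight (mu : hdual) : Prop :=
  mu != 0 /\ exists2 v, v != 0 & weight_space mu v.

Definition real_weight_space (mu : hdual) : set V :=
  [set u | exists v w, [/\ weight_space mu v, weight_space (- mu) w &
                          to_cplx u = v + w]].

Definition real_zero_weight_space : set V :=
  [set u | weight_space 0 (to_cplx u)].

End Module.

Variable br : g0 -> g0 -> g0.

Definition is_root (alpha : hdual) : Prop := nonzero_weight br alpha.

Definition is_root_base (Delta : seq hdual) : Prop :=
  [/\ basis_of fullv Delta,
      forall alpha, alpha \in Delta -> is_root alpha &
      forall beta, is_root beta -> exists k : 'I_(size Delta) -> nat,
        beta = \sum_(i < size Delta) Delta`_i *+ k i \/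
        beta = - \sum_(i < size Delta) Delta`_i *+ k i].

Definition is_positive_root (Delta : seq hdual) (beta : hdual) : Prop :=
  is_root beta /\
  exists k : 'I_(size Delta) -> nat,
    beta = \sum_(i < size Delta) Delta`_i *+ k i.

Definition is_root_vector (alpha : hdual) (H : cplx g0) : Prop :=
  H \in cplx_vs h0 /\
  forall K, K \in cplx_vs h0 ->
    lie_killing (cplx_bil br) K H = heval alpha K.

(* tau_alpha, given H = H_alpha *)
Definition tau (H : cplx g0) : cplx g0 :=
  (2 / lie_killing (cplx_bil br) H H) *: H.

(* Phi and Phip enumerate the roots and the positive roots, Hr alpha is
   H_alpha, and C0 lists the compact Chevalley basis, as elements of g0. *)
Record compact_chevalley (Delta Phi Phip : seq hdual)
    (Hr X : hdual -> cplx g0) (C : hdual -> hdual -> R[i])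
    (C0 : seq g0) : Prop := CompactChevalley {
  chev_base : is_root_base Delta;
  chev_roots_uniq : uniq Phi;
  chev_roots : forall beta, beta \in Phi <-> is_root beta;
  chev_pos_uniq : uniq Phip;
  chev_pos : forall beta, beta \in Phip <-> is_positive_root Delta beta;
  chev_Hr : forall alpha, is_root alpha -> is_root_vector alpha (Hr alpha);
  chev_basis : basis_of fullv
    ([seq X beta | beta <- Phi] ++ [seq tau (Hr alpha) | alpha <- Delta]);
  chev_X : forall beta, is_root beta -> weight_space br beta (X beta);
  chev_opp : forall alpha, is_root alpha ->
    cplx_bil br (X alpha) (X (- alpha)) = tau (Hr alpha);
  chev_add : forall alpha beta,
    is_root alpha -> is_root beta -> is_root (alpha + beta) ->
    cplx_bil br (X alpha) (X beta) = C alpha beta *: X (alpha + beta);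
  chev_const : forall alpha beta,
    is_root alpha -> is_root beta -> is_root (alpha + beta) ->
    C alpha beta = - C (- alpha) (- beta);
  chev_compact :
    [seq to_cplx x | x <- C0] =
      [seq 'i%C *: tau (Hr alpha) | alpha <- Delta] ++
      [seq X beta - X (- beta) | beta <- Phip] ++
      [seq 'i%C *: X beta + 'i%C *: X (- beta) | beta <- Phip];
  chev_compact_basis : basis_of fullv C0 }.

End Weights.

Section ChevalleyRational.
Variables (R : realType) (g0 U : vectType R) (h0 : {vspace g0}).
Variables (br : g0 -> g0 -> g0) (act : g0 -> U -> U).

Definition adapted_module_basis (C0 : seq g0) (B0 : seq U) : Prop :=
  [/\ basis_of fullv B0,
      forall Z u, Z \in C0 -> Qspan B0 u -> Qspan B0 (act Z u) &
      exists (Bzero : seq U) (Bw : hdual h0 -> seq U),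
        [/\ has_basis (real_zero_weight_space h0 act) Bzero,
            forall mu, nonzero_weight act mu ->
              has_basis (real_weight_space act mu) (Bw mu) &
            forall u, u \in B0 <->
              u \in Bzero \/ exists2 mu, nonzero_weight act mu & u \in Bw mu]].

Definition rational_frame (B0 : seq U) (C0 : seq g0) : seq (U * g0)%type :=
  [seq (u, 0) | u <- B0] ++ [seq (0, Z) | Z <- C0].

Definition admissible_inner_product (B0 : seq U) (C0 : seq g0)
    (ip : U * g0 -> U * g0 -> R) : Prop :=
  [/\ is_inner_product ip,
      forall u Z, ip (u, 0) (0, Z) = 0,
      forall Z u v, ip (act Z u, 0) (v, 0) = - ip (u, 0) (act Z v, 0),
      forall Y Z, ip (0, Y) (0, Z) = - lie_killing br Y Z &
      forall x y, x \in rational_frame B0 C0 -> y \in rational_frame B0 C0 ->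
        exists q : rat, ip x y = ratr q].

Definition nilpotent_bracket (ip : U * g0 -> U * g0 -> R)
    (bn : U * g0 -> U * g0 -> U * g0) : Prop :=
  [/\ is_lie_bracket bn,
      forall x Z, bn x (0, Z) = 0,
      forall x y, (bn x y).1 = 0 &
      forall u v Z, ip (bn (u, 0) (v, 0)) (0, Z) = ip (act Z u, 0) (v, 0)].

(* H = \tilde H_lambda *)
Definition is_dual_vector (ip : U * g0 -> U * g0 -> R) (lambda : hdual h0)
    (H : g0) : Prop :=
  H \in h0 /\
  forall K, K \in h0 ->
    ((ip (0, K) (0, H))%:C)%C = - 'i%C * heval lambda (to_cplx K).

Definition n0_weight (lambda : hdual h0) (H : g0) : set (U * g0) :=
  [set x | real_weight_space act lambda x.1 /\ exists c : R, x.2 = c *: H].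

End ChevalleyRational.

(* Main.v *)
Require Import Defs.
From HB Require Import structures.
From mathcomp Require Import all_boot all_order all_algebra.
From mathcomp Require Import complex.
From mathcomp Require Import boolp classical_sets reals.
From mathcomp Require Import ring lra.

Set Implicit Arguments.
Unset Strict Implicit.
Unset Printing Implicit Defensive.

Import Order.TTheory GRing.Theory Num.Theory.
Local Open Scope classical_set_scope.
Local Open Scope ring_scope.

(** Elements [H] of [h0] act on [U] by skew maps, so a weight [lambda] takes
    imaginary values on [h0]: [lambda H = i a(H)] with [a(H) = <H, Hl>], which
    is what the definition of [Hl] says. A vector [u + i y] of [V] then has
    weight [lambda] exactly when every [H] in [h0] rotates the pair [(u, y)]
    with speed [a(H)], and the vectors [u] that have such a partner [y] form
    [U_lambda] ([real_weight_spaceE]).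

    The heart of the matter is that [[u, v]] lies on the line of [Hl] for [u]
    and [v] in [U_lambda] ([bracket_rotates]). Since [ad H] is a skew derivation
    (this uses the invariance of the Killing form), [[V_lambda, V_lambda]] is
    contained in the weight space of [2 lambda] in the complexification of
    [g0], which vanishes because [2 lambda] is neither zero nor a root; what
    remains of [[u, v]] comes from [[V_lambda, V_(-lambda)]], has weight zero,
    and so commutes with [h0]. As [h0] is maximal abelian, [[u, v]] lies in
    [h0], and pairing it with [H] in [h0] gives
    [<[u, v], H> = <H u, v> = - a(H) <y, v>], that is, [[u, v] = - <y, v> Hl].

    All four claims follow. The subspace is closed under the bracket. It is
    totally geodesic because, by the Koszul formula, the connection of a 2-step
    nilpotent algebra only involves [[u, v]] and the action of [Hl], which maps
    [u] to a multiple of its partner [y], again in [U_lambda]. Its center is the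
    line of [Hl] because [[u, y] = - |y|^2 Hl] vanishes only for [u = 0]. For
    rationality, [U_lambda] is spanned by a part of [B0], and some bracket of
    two vectors of that part is a nonzero multiple of [Hl]; this bracket is
    rational because its inner products with the basis [C0] are rational, and
    so is the Gram matrix of [C0] ([Qspan_gram]). *)

(** * Bilinear maps and inner products *)

Section BilinearMap.
Variables (F : fieldType) (V1 V2 V3 : lmodType F) (f : V1 -> V2 -> V3).
Hypothesis f_bil : bilinear_map f.

Lemma bilDl x y z : f (x + y) z = f x z + f y z.
Proof. by have := f_bil.2 z 1 x y; rewrite !scale1r. Qed.

Lemma bilDr x y z : f x (y + z) = f x y + f x z.
Proof. by have := f_bil.1 x 1 y z; rewrite !scale1r. Qed.

Lemma bil0l z : f 0 z = 0.
Proof. by apply: (addrI (f 0 z)); rewrite -bilDl !addr0. Qed.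

Lemma bil0r x : f x 0 = 0.
Proof. by apply: (addrI (f x 0)); rewrite -bilDr !addr0. Qed.

Lemma bilZl c x z : f (c *: x) z = c *: f x z.
Proof. by have := f_bil.2 z c x 0; rewrite bil0l !addr0. Qed.

Lemma bilZr c x y : f x (c *: y) = c *: f x y.
Proof. by have := f_bil.1 x c y 0; rewrite bil0r !addr0. Qed.

Lemma bilNl x z : f (- x) z = - f x z.
Proof. by rewrite -scaleN1r bilZl scaleN1r. Qed.

Lemma bilNr x y : f x (- y) = - f x y.
Proof. by rewrite -scaleN1r bilZr scaleN1r. Qed.

Lemma bil_suml I (r : seq I) (P : pred I) (g : I -> V1) z :
  f (\sum_(i <- r | P i) g i) z = \sum_(i <- r | P i) f (g i) z.
Proof. by apply: (big_morph (f^~ z)) => [x y|]; rewrite ?bilDl ?bil0l. Qed.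

Lemma bil_sumr I (r : seq I) (P : pred I) (g : I -> V2) x :
  f x (\sum_(i <- r | P i) g i) = \sum_(i <- r | P i) f x (g i).
Proof. by apply: (big_morph (f x)) => [y z|]; rewrite ?bilDr ?bil0r. Qed.

End BilinearMap.

Lemma lie_bracketC (F : fieldType) (L : vectType F) (br : L -> L -> L) x y :
  is_lie_bracket br -> br x y = - br y x.
Proof.
case=> br_bil br_alt _; apply/eqP; rewrite -addr_eq0; apply/eqP.
by have := br_alt (x + y); rewrite (bilDl br_bil) !(bilDr br_bil) !br_alt
  add0r addr0.
Qed.

Section InnerProduct.
Variables (R : realType) (L : vectType R) (ip : L -> L -> R).
Hypothesis ip_inner : is_inner_product ip.

Lemma ipC x y : ip x y = ip y x.
Proof. by case: ip_inner. Qed.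

Lemma inner_bilinear : bilinear_map (ip : L -> L -> R^o).
Proof.
case: ip_inner => ipC' ip_lin _; split=> [x|y] c u v; first exact: ip_lin.
by rewrite !(ipC' _ y) ip_lin.
Qed.

Lemma inner_eq0 x : ip x x = 0 -> x = 0.
Proof.
case: ip_inner => _ _ ip_pos; have [//|/ip_pos] := eqVneq x 0.
by move=> /[swap] ->; rewrite ltxx.
Qed.

Lemma inner_eq x y : (forall z, ip x z = ip y z) -> x = y.
Proof.
move=> xy; apply/eqP; rewrite -subr_eq0; apply/eqP/inner_eq0.
by rewrite (bilDl inner_bilinear) (bilNl inner_bilinear) xy subrr.
Qed.

(** The Koszul formula: exchanging the two last vectors by metric compatibility
    and the two first ones by vanishing torsion, three times in alternation,
    turns [ip (nabla x y) z] into its opposite plus bracket terms. *)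
Lemma koszul (bn nabla : L -> L -> L) x y z :
  is_levi_civita bn ip nabla ->
  ip (nabla x y) z *+ 2 = ip (bn x y) z - ip (bn x z) y - ip (bn y z) x.
Proof.
case=> _ torsion metric.
have tor u v w : ip (nabla u v) w = ip (bn u v) w + ip (nabla v u) w.
  by rewrite -torsion (bilDl inner_bilinear) (bilNl inner_bilinear) subrK.
have met u v w : ip (nabla u v) w = - ip (nabla u w) v.
  by apply/eqP; rewrite -addr_eq0 (ipC (nabla u w)) metric.
have := tor x y z; have := tor x z y; have := tor y z x.
have := met x y z; have := met y x z; have := met z x y.
lra.
Qed.

End InnerProduct.

(** * Invariance of the Killing form *)

Section Killing.
Variables (F : fieldType) (L : vectType F) (br : L -> L -> L).
Hypothesis br_lie : is_lie_bracket br.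

Let e := vbasis {:L}.

(** Rows hold the images of the basis vectors, so that a composite of adjoint
    maps becomes the product of their matrices in reverse order. *)
Definition ad_mx (x : L) : 'M[F]_(\dim {:L}) :=
  \matrix_(i, j) coord e j (br x e`_i).

Lemma brE x v : br x v = \sum_j coord e j v *: br x e`_j.
Proof.
case: br_lie => br_bil _ _; rewrite [in LHS](coord_vbasis (memvf v)).
by rewrite (bil_sumr br_bil); apply: eq_bigr => j _; rewrite (bilZr br_bil).
Qed.

Lemma coord_br_br x y (i k : 'I_(\dim {:L})) :
  coord e k (br x (br y e`_i)) = (ad_mx y *m ad_mx x) i k.
Proof.
rewrite brE linear_sum mxE; apply: eq_bigr => j _.
by rewrite linearZ /= !mxE.
Qed.

Lemma killing_tr x y : lie_killing br x y = \tr (ad_mx y *m ad_mx x).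
Proof. by apply: eq_bigr => i _; rewrite -coord_br_br. Qed.

Lemma ad_mx_br x y : ad_mx (br x y) = ad_mx y *m ad_mx x - ad_mx x *m ad_mx y.
Proof.
apply/matrixP => i k; rewrite [LHS]mxE [RHS]mxE [X in _ + X]mxE.
rewrite -!coord_br_br -linearB /=; congr (coord e k _).
case: (br_lie) => br_bil _ jacobi; have := jacobi x y e`_i.
rewrite (lie_bracketC e`_i x br_lie) (lie_bracketC e`_i (br x y) br_lie).
by rewrite (bilNr br_bil) => /eqP; rewrite subr_eq0 => /eqP.
Qed.

(** The Jacobi identity makes [ad_mx] turn brackets into commutators; the trace
    of a product is unchanged by cyclic permutation of the factors. *)
Lemma killing_invariant h x y :
  lie_killing br (br h x) y + lie_killing br x (br h y) = 0.
Proof.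
rewrite !killing_tr !ad_mx_br mulmxBr mulmxBl !raddfB /= !mulmxA addrA subrK.
by rewrite (mxtrace_mulC (_ *m _) (ad_mx h)) mulmxA subrr.
Qed.

End Killing.

(** * Weights as planes of rotation *)

Section Rotation.
Variables (R : realType) (g0 : vectType R) (h0 : {vspace g0}).
Implicit Types (mu nu : hdual h0) (a : g0 -> R).

Lemma hevalD mu nu H : heval (mu + nu) H = heval mu H + heval nu H.
Proof. exact: (add_lfunE (mu : 'Hom(_, _)) nu). Qed.

Lemma hevalN mu H : heval (- mu) H = - heval mu H.
Proof. exact: (opp_lfunE (mu : 'Hom(_, _))). Qed.

Lemma heval_linear mu c H K :
  heval mu (c *: H + K) = c * heval mu H + heval mu K.
Proof. by rewrite /heval !linearP. Qed.

Definition imaginary_weight mu a :=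
  forall K, K \in h0 -> heval mu (to_cplx K) = (0 +i* a K)%C.

Lemma cplxE (V : vectType R) (x : cplx V) :
  x = 'i%C *: to_cplx x.2 + to_cplx x.1.
Proof.
case: x => x y; congr pair => /=.
- by rewrite scale0r scaler0 subr0 add0r.
- by rewrite scale0r scale1r add0r addr0.
Qed.

Lemma heval_imaginary mu a (H : cplx g0) : imaginary_weight mu a ->
  H \in cplx_vs h0 -> heval mu H = (- a H.2 +i* a H.1)%C.
Proof.
move=> mu_a; rewrite mem_cplx_vs => /andP[H1 H2].
rewrite [H in LHS]cplxE heval_linear !mu_a //=.
by apply/eqP; rewrite eq_complex /= !(mul0r, mul1r, mulr0, addr0, add0r) !eqxx.
Qed.

Section Module.
Variables (V : vectType R) (act : g0 -> V -> V).
Hypothesis act_bil : bilinear_map act.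

(** The real form of the condition that [x + i y] be a vector of weight
    [i a]. *)
Definition rotates a (x y : V) :=
  forall K, K \in h0 -> act K x = - (a K *: y) /\ act K y = a K *: x.

(** Multiplication of [x + i y] by [- i]. *)
Lemma rotates_turn a x y : rotates a x y -> rotates a y (- x).
Proof.
move=> xy K /xy[Kx Ky].
by rewrite (bilNr act_bil) Kx Ky scalerN !opprK.
Qed.

Lemma weight_spaceE mu a x y : imaginary_weight mu a ->
  weight_space act mu ((x, y) : cplx V) <-> rotates a x y.
Proof.
move=> mu_a; split=> [xy K hK | xy H hH].
- have /xy : to_cplx K \in cplx_vs h0 by rewrite mem_cplx_vs hK mem0v.
  rewrite mu_a // => -[] /=.
  by rewrite !(bil0l act_bil) !scale0r subr0 sub0r addr0 add0r.
- rewrite (heval_imaginary mu_a hH).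
  move: hH; rewrite mem_cplx_vs => /andP[/xy[x1 y1] /xy[x2 y2]].
  by congr pair; rewrite /= ?x1 ?x2 ?y1 ?y2 !scaleNr 1?[RHS]addrC 1?addrC.
Qed.

(** If [v + w] is real with [v] of weight [mu] and [w] of weight [- mu], then
    [v] plus the conjugate of [w] has weight [mu], because [mu] is imaginary on
    [h0], and its real part is [v + w]. Conversely the real part of a vector of
    weight [mu] is half the sum of that vector and its conjugate. *)
Lemma real_weight_spaceE mu a u : imaginary_weight mu a ->
  real_weight_space act mu u <-> exists y, rotates a u y.
Proof.
move=> mu_a; have muN_a : imaginary_weight (- mu) (fun K => - a K).
  move=> K hK; rewrite hevalN mu_a //.
  by apply/eqP; rewrite eq_complex /= oppr0 !eqxx.
split=> [[[x y] [[x' y'] []]] | [y uy]].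
- move=> /(weight_spaceE _ _ mu_a) xy /(weight_spaceE _ _ muN_a) xy' [].
  move=> -> /esym/eqP; rewrite /= addrC addr_eq0 => /eqP y'E.
  exists (y *+ 2) => K hK; have [Kx Ky] := xy K hK; have [Kx' Ky'] := xy' K hK.
  move: Kx' Ky'; rewrite y'E (bilNr act_bil) !scaleNr scalerN !opprK => Kx'.
  move/oppr_inj => Ky'; split.
    by rewrite (bilDr act_bil) Kx Kx' mulr2n scalerDr opprD.
  by rewrite mulr2n scalerDr (bilDr act_bil) {1}Ky Ky'.
- pose v : cplx V := (2^-1 *: u, 2^-1 *: y).
  pose w : cplx V := (2^-1 *: u, - (2^-1 *: y)).
  exists v, w; split.
  + apply/(weight_spaceE _ _ mu_a) => K /uy[Ku Ky].
    by rewrite !(bilZr act_bil) Ku Ky scalerN !scalerA mulrC.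
  + apply/(weight_spaceE _ _ muN_a) => K /uy[Ku Ky].
    rewrite (bilNr act_bil) !(bilZr act_bil) Ku Ky !scalerN !scaleNr.
    by rewrite !scalerA opprK mulrC.
  + by congr pair; rewrite /= ?subrr // -scalerDl -[2^-1]mul1r -splitr scale1r.
Qed.

End Module.
End Rotation.

(** * Rational spans *)

Section RationalSpan.
Variable R : realType.

Lemma Qspan_ind (L : vectType R) (s : seq L) (P : L -> Prop) :
  P 0 -> (forall x y, P x -> P y -> P (x + y)) ->
  (forall q x, x \in s -> P (ratr q *: x)) ->
  forall x, Qspan s x -> P x.
Proof.
move=> P0 PD PZ _ [q ->]; apply: (big_ind P) => // i _.
exact/PZ/mem_nth.
Qed.

Lemma mem_Qspan (L : vectType R) (s : seq L) x : x \in s -> Qspan s x.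
Proof.
move=> xs; exists (fun i => (nat_of_ord i == index x s)%:R).
have lt_x : (index x s < size s)%N by rewrite index_mem.
rewrite (bigD1 (Ordinal lt_x)) //= eqxx rmorph1 scale1r nth_index //.
rewrite big1 ?addr0 // => i; rewrite -val_eqE /= => /negPf ->.
by rewrite rmorph0 scale0r.
Qed.

Lemma Qspan0 (L : vectType R) (s : seq L) : Qspan s 0.
Proof.
by exists (fun _ => 0); rewrite big1 // => i _; rewrite rmorph0 scale0r.
Qed.

Lemma QspanD (L : vectType R) (s : seq L) x y :
  Qspan s x -> Qspan s y -> Qspan s (x + y).
Proof.
move=> [p ->] [q ->]; exists (fun i => p i + q i); rewrite -big_split.
by apply: eq_bigr => i _; rewrite /= rmorphD scalerDl.
Qed.

Lemma QspanZ (L : vectType R) (s : seq L) q x :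
  Qspan s x -> Qspan s (ratr q *: x).
Proof.
move=> [p ->]; exists (fun i => q * p i); rewrite scaler_sumr.
by apply: eq_bigr => i _; rewrite rmorphM scalerA.
Qed.

Lemma Qspan_linear (L L' : vectType R) (s : seq L) (t : seq L')
    (f : {linear L -> L'}) x :
  (forall y, y \in s -> f y \in t) -> Qspan s x -> Qspan t (f x).
Proof.
move=> f_st; move: x.
apply: Qspan_ind => [|x y fx fy|q x /f_st/mem_Qspan fx].
- by rewrite linear0; exact: Qspan0.
- by rewrite linearD; exact: QspanD.
- by rewrite linearZ; exact: QspanZ.
Qed.

(** The coordinates of [z] in the basis [s] solve a linear system whose matrix,
    the Gram matrix of [s], and whose right-hand side are rational; it is
    invertible because the inner product is definite. *)
Lemma Qspan_gram (L : vectType R) (ip : L -> L -> R) (s : seq L) z :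
  is_inner_product ip -> basis_of fullv s ->
  (forall x y, x \in s -> y \in s -> exists q : rat, ip x y = ratr q) ->
  (forall y, y \in s -> exists q : rat, ip z y = ratr q) ->
  Qspan s z.
Proof.
move=> ip_inner s_basis gram_rat z_rat.
have ip_bil := inner_bilinear ip_inner.
have s_span x : x = \sum_(i < size s) coord (in_tuple s) i x *: s`_i.
  apply: (@coord_span _ _ _ (in_tuple s)).
  by rewrite /= (span_basis s_basis) memvf.
have in_s (i : 'I_(size s)) : s`_i \in s by rewrite mem_nth.
have [G GE] : {G : 'I_(size s) -> 'I_(size s) -> rat |
    forall i j : 'I_(size s), ip s`_i s`_j = ratr (G i j)}.
  have [G GP] := choice (fun ij : 'I_(size s) * 'I_(size s) =>
    gram_rat _ _ (in_s ij.1) (in_s ij.2)).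
  by exists (fun i j => G (i, j)) => i j; exact: (GP (i, j)).
have [r rE] := choice (fun i => z_rat _ (in_s i)).
pose GQ : 'M[rat]_(size s) := \matrix_(i, j) G i j.
pose GR := map_mx (ratr : rat -> R) GQ.
pose sum_s (c : 'rV[R]_(size s)) := \sum_i c 0 i *: s`_i.
have gramE c (j : 'I_(size s)) : ip (sum_s c) s`_j = (c *m GR) 0 j.
  rewrite (bil_suml ip_bil) mxE; apply: eq_bigr => i _.
  by rewrite (bilZl ip_bil) !mxE -GE.
have GR_unit : GR \in unitmx.
  rewrite -row_free_unit; apply: inj_row_free => c cG0.
  have sum_c0 : sum_s c = 0.
    apply: (inner_eq0 ip_inner); rewrite (bil_sumr ip_bil) big1 // => j _.
    by rewrite (bilZr ip_bil) gramE cG0 mxE scaler0.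
  apply/rowP => i; rewrite mxE.
  have /freeP s_free : free (in_tuple s) := basis_free s_basis.
  exact: (s_free (fun j => c 0 j) sum_c0 i).
pose c : 'rV[R]_(size s) := \row_i coord (in_tuple s) i z.
have zE : z = sum_s c.
  by rewrite {1}(s_span z); apply: eq_bigr => i _; rewrite mxE.
pose rQ : 'rV[rat]_(size s) := \row_j r j.
have cG : c *m GR = map_mx ratr rQ.
  by apply/rowP => j; rewrite -gramE -zE rE !mxE.
have {cG} cQ : c = map_mx ratr (rQ *m invmx GQ).
  by rewrite map_mxM map_invmx -cG mulmxK.
by exists (fun i => (rQ *m invmx GQ) 0 i); rewrite zE cQ; apply: eq_bigr => i _;
  rewrite mxE.
Qed.

End RationalSpan.

(** * The 2-step nilpotent metric Lie algebra *)

Section ProductBasis.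
Variables (F : fieldType) (V W : vectType F).

Definition in1 (u : V) : V * W := (u, 0).
Definition in2 (w : W) : V * W := (0, w).

Lemma in1_linear : linear in1.
Proof. by move=> c u v; congr pair; rewrite /= scaler0 addr0. Qed.
HB.instance Definition _ := GRing.isLinear.Build F V (V * W)%type _
  in1 in1_linear.

Lemma in2_linear : linear in2.
Proof. by move=> c u v; congr pair; rewrite /= scaler0 addr0. Qed.
HB.instance Definition _ := GRing.isLinear.Build F W (V * W)%type _
  in2 in2_linear.

Lemma in12E (x : V * W) : x = in1 x.1 + in2 x.2.
Proof. by case: x => u w; congr pair; rewrite /= ?addr0 ?add0r. Qed.

Lemma product_basis (B : seq V) (h : W) : free B -> h != 0 ->
  has_basis [set x | x.1 \in <<B>>%VS /\ exists c, x.2 = c *: h]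
    (in2 h :: map in1 B).
Proof.
move=> B_free h_neq0; have imB : <<map in1 B>>%VS = (linfun in1 @: <<B>>)%VS.
  by rewrite limg_span; congr <<_>>%VS; apply: eq_map => u; rewrite lfunE.
have mem_imB x : x \in (linfun in1 @: <<B>>)%VS <-> x.1 \in <<B>>%VS /\ x.2 = 0.
  split=> [/memv_imgP[u uB ->] | [x1 x2]]; first by rewrite lfunE.
  by rewrite (in12E x) x2 linear0 addr0 -[in1 _]lfunE memv_img.
split.
- rewrite free_cons imB; apply/andP; split.
    by apply/negP => /mem_imB[_] /eqP; apply/negP.
  rewrite /free imB size_map limg_dim_eq; first exact: B_free.
  apply/eqP; rewrite -subv0; apply/subvP => u; rewrite memv_cap memv_ker lfunE.
  by case/andP=> _ /eqP[->]; rewrite mem0v.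
- apply/seteqP; split=> x /=; rewrite span_cons imB.
  + case=> x1 [c x2]; rewrite (in12E x) x2 addrC linearZ.
    apply: memv_add; first by rewrite memvZ ?memv_line.
    exact/mem_imB.
  + case/memv_addP=> _ /vlineP[c ->] [y /mem_imB[y1 y2] ->] /=.
    by rewrite scaler0 add0r y2 addr0; split => //; exists c.
Qed.

End ProductBasis.

(** Otherwise [h + <[z]>] would be a larger abelian subspace. *)
Lemma centralizer_maximal_abelian (F : fieldType) (L : vectType F)
    (br : L -> L -> L) (h : {vspace L}) z :
  is_lie_bracket br -> maximal_abelian br h ->
  (forall k, k \in h -> br k z = 0) -> z \in h.
Proof.
move=> br_lie [h_ab h_max] hz; have [br_bil br_alt _] := br_lie.
rewrite -(h_max (h + <[z]>)%VS) ?addvSl ?memvE ?addvSr // => x y.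
case/memv_addP=> k hk [_ /vlineP[c ->] ->].
case/memv_addP=> k' hk' [_ /vlineP[c' ->] ->].
rewrite (bilDl br_bil) !(bilDr br_bil) !(bilZl br_bil) !(bilZr br_bil).
rewrite h_ab // hz // (lie_bracketC z k' br_lie) hz // br_alt.
by rewrite oppr0 !scaler0 !addr0.
Qed.

Section MetricNilpotent.
Variables (R : realType) (g0 U : vectType R).
Variables (br : g0 -> g0 -> g0) (act : g0 -> U -> U) (h0 : {vspace g0}).
Variables (B0 : seq U) (C0 : seq g0).
Variables (ip : U * g0 -> U * g0 -> R) (bn : U * g0 -> U * g0 -> U * g0).
Hypothesis br_lie : is_lie_bracket br.
Hypothesis act_lie : is_lie_action br act.
Hypothesis ip_adm : admissible_inner_product br act B0 C0 ip.
Hypothesis bn_def : nilpotent_bracket act ip bn.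

Definition ipU (u v : U) : R := ip (u, 0) (v, 0).
Definition ipg (Y Z : g0) : R := ip (0, Y) (0, Z).
Definition brU (u v : U) : g0 := (bn (u, 0) (v, 0)).2.

Let br_bil : bilinear_map br. Proof. by case: br_lie. Qed.
Let act_bil : bilinear_map act. Proof. by case: act_lie. Qed.
Let ip_inner : is_inner_product ip. Proof. by case: ip_adm. Qed.
Let ip_bil := inner_bilinear ip_inner.

Lemma ip_split x y : ip x y = ipU x.1 y.1 + ipg x.2 y.2.
Proof.
have ip_orth u Z : ip (u, 0) (0, Z) = 0 by case: ip_adm.
rewrite [in LHS](in12E x) [in LHS](in12E y) (bilDl ip_bil) !(bilDr ip_bil).
by rewrite (ipC ip_inner (in2 _ _)) /in1 /in2 !ip_orth addr0 add0r.
Qed.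

Lemma ipU_inner : is_inner_product ipU.
Proof.
split=> [u v|u c v w|u u_neq0]; first exact: (ipC ip_inner).
- rewrite /ipU; have -> : (c *: v + w, 0) = in1 g0 (c *: v + w) by [].
  by rewrite linearP (bilDr ip_bil) (bilZr ip_bil).
- case: ip_inner => _ _; apply.
  by apply: contra u_neq0 => /eqP/(congr1 fst) /= ->.
Qed.

Lemma ipg_inner : is_inner_product ipg.
Proof.
split=> [u v|u c v w|u u_neq0]; first exact: (ipC ip_inner).
- rewrite /ipg; have -> : (0, c *: v + w) = in2 U (c *: v + w) by [].
  by rewrite linearP (bilDr ip_bil) (bilZr ip_bil).
- case: ip_inner => _ _; apply.
  by apply: contra u_neq0 => /eqP/(congr1 snd) /= ->.
Qed.

Let ipU_bil := inner_bilinear ipU_inner.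
Let ipg_bil := inner_bilinear ipg_inner.

Lemma ipU_skew Z u v : ipU (act Z u) v = - ipU u (act Z v).
Proof. by case: ip_adm => _ _ skew _ _; exact: skew. Qed.

Lemma ipg_skew Z Y Y' : ipg (br Z Y) Y' = - ipg Y (br Z Y').
Proof.
case: ip_adm => _ _ _ ipgE _; apply/eqP; rewrite /ipg !ipgE opprK eqr_oppLR.
by rewrite -addr_eq0 killing_invariant.
Qed.

(** With the next lemma, the reduction of the algebra to the single bilinear map
    [brU], dual to the action of [g0] on [U]. *)
Lemma brUP u v Z : ipg (brU u v) Z = ipU (act Z u) v.
Proof.
case: bn_def => _ _ bn1 bnP; have := bnP u v Z.
by rewrite ip_split bn1 /= (bil0l ipU_bil) add0r.
Qed.

Lemma bnE x y : bn x y = (0, brU x.1 y.1).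
Proof.
case: bn_def => bn_lie bn0 bn1 _; have [bn_bil _ _] := bn_lie.
rewrite [in LHS](in12E x) [in LHS](in12E y) (bilDl bn_bil) !(bilDr bn_bil).
rewrite /in2 !bn0 (lie_bracketC (0, _) _ bn_lie) bn0 oppr0 !addr0.
by rewrite [LHS]surjective_pairing bn1.
Qed.

Lemma brU_bilinear : bilinear_map brU.
Proof.
have ext := inner_eq ipg_inner.
split=> [u|v] c w w'; apply: ext => Z.
- rewrite brUP (bilDl ipg_bil) (bilZl ipg_bil) !brUP.
  by rewrite (bilDr ipU_bil) (bilZr ipU_bil).
- rewrite brUP (bilDl ipg_bil) (bilZl ipg_bil) !brUP.
  rewrite (bilDr act_bil) (bilZr act_bil).
  by rewrite (bilDl ipU_bil) (bilZl ipU_bil).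
Qed.

(** Elements of [g0] act as derivations on the whole algebra, because the action
    on [U] and the adjoint action are both skew. *)
Lemma br_brU Z u v : br Z (brU u v) = brU (act Z u) v + brU u (act Z v).
Proof.
apply: (inner_eq ipg_inner) => Y; rewrite ipg_skew (bilDl ipg_bil) !brUP.
have [_ act_br] := act_lie; rewrite act_br (bilDl ipU_bil) (bilNl ipU_bil).
by rewrite ipU_skew !opprD !opprK addrC.
Qed.

(** The connection of a 2-step nilpotent metric algebra, which the Koszul formula
    determines: [nabla_u v = [u, v] / 2], [nabla_u Z = nabla_Z u = - Z u / 2] and
    [nabla_Z Z' = 0]. *)
Lemma levi_civitaE nabla x y : is_levi_civita bn ip nabla ->
  nabla x y =
    (- 2^-1 *: (act x.2 y.1 + act y.2 x.1), 2^-1 *: brU x.1 y.1).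
Proof.
move=> nabla_lc; apply: (inner_eq ip_inner) => z.
apply: (@mulIf _ 2) => //; first by rewrite pnatr_eq0.
rewrite mulr_natr (koszul ip_inner _ _ _ nabla_lc) !bnE !ip_split /=.
rewrite !(bil0l ipU_bil) !add0r (bilZl ipU_bil) (bilZl ipg_bil).
rewrite !brUP (bilDl ipU_bil) (ipU_skew y.2) (ipC ipU_inner x.1).
rewrite (ipU_skew x.2) (ipC ipU_inner y.1).
set p := ipU _ _; set q := ipU _ _; set r := ipU _ _.
have scaleE (c d : R) : c *: (d : R^o) = c * d by [].
by rewrite !scaleE; lra.
Qed.


(** * The subalgebra attached to a weight *)

Section Weight.
Hypothesis h0_max : maximal_abelian br h0.
Variables (lambda : hdual h0) (Hl : g0).
Hypothesis lambda_weight : nonzero_weight act lambda.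
Hypothesis Hl_dual : is_dual_vector ip lambda Hl.
Hypothesis lambda2 : ~ is_root br (lambda *+ 2).

Let a (K : g0) : R := ipg K Hl.

Lemma dual_imaginary : imaginary_weight lambda a.
Proof.
move=> K hK; case: Hl_dual => _ /(_ K hK); rewrite -/(ipg K Hl) -/(a K).
case: (heval _ _) => p q /eqP; rewrite eq_complex /=.
rewrite !(mul0r, mulN1r, mulNr, mul1r, oppr0, add0r, opprK, addr0, sub0r, subr0).
by case/andP=> /eqP -> /eqP/esym/eqP; rewrite oppr_eq0 => /eqP ->.
Qed.

Lemma double_imaginary : imaginary_weight (lambda *+ 2) (fun K => a K *+ 2).
Proof.
move=> K hK; rewrite mulr2n hevalD dual_imaginary //.
by apply/eqP; rewrite eq_complex /= addr0 mulr2n !eqxx.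
Qed.

(** A zero [Hl] would make [lambda] vanish on [h0], hence on its
    complexification. *)
Lemma dual_vector_neq0 : Hl != 0.
Proof.
case: lambda_weight => lambda_neq0 _; apply: contra lambda_neq0 => /eqP Hl0.
apply/eqP/lfunP => w; rewrite zero_lfunE -[w]vsvalK.
have a0 K : a K = 0 by rewrite /a Hl0 (bil0r ipg_bil).
have := heval_imaginary dual_imaginary (subvsP w); rewrite !a0 oppr0.
exact.
Qed.

Lemma dual_norm_neq0 : a Hl != 0.
Proof.
apply: contra dual_vector_neq0 => /eqP aH0; apply/eqP.
exact: (inner_eq0 ipg_inner).
Qed.

(** This is where the hypothesis on [2 lambda] enters: it kills the component of
    [brU u v] that comes from [[V_lambda, V_lambda]] and its conjugate, leaving
    the component of weight zero. *)
Lemma bracket_commute u v y w :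
  rotates h0 act a u y -> rotates h0 act a v w ->
  forall K, K \in h0 -> br K (brU u v) = 0.
Proof.
move=> uy vw; have brU_bil := brU_bilinear.
(* p + i q is the bracket of u + i y with v + i w, of weight 2 lambda. *)
pose p := brU u v - brU y w; pose q := brU u w + brU y v.
have pq_rot : rotates h0 br (fun K => a K *+ 2) p q.
  move=> K hK; have [Ku Ky] := uy K hK; have [Kv Kw] := vw K hK.
  rewrite /p /q !(bilDr br_bil) (bilNr br_bil) !br_brU Ku Ky Kv Kw.
  rewrite !(bilNl brU_bil) !(bilNr brU_bil) !(bilZl brU_bil) !(bilZr brU_bil).
  rewrite !mulr2n !scalerDl !scalerDr !scalerN !opprD.
  by split; congr (_ + _); rewrite addrC.
have q0 : q = 0.
  have [pq0|pq_neq0] := eqVneq ((p, q) : cplx g0) 0.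
    by have := congr1 snd pq0.
  case: lambda2; split; last first.
    by exists (p, q) => //; apply/(weight_spaceE br_bil _ _ double_imaginary).
  case: lambda_weight => lambda_neq0 _.
  by rewrite -scaler_nat scaler_eq0 pnatr_eq0.
move=> K hK; rewrite br_brU (uy K hK).1 (vw K hK).1.
rewrite (bilNl brU_bil) (bilNr brU_bil) (bilZl brU_bil) (bilZr brU_bil).
(* The derivation rule leaves a multiple of q. *)
by rewrite -opprD -scalerDr addrC -/q q0 scaler0 oppr0.
Qed.

(** Both sides lie in [h0], where the inner product is definite, so it is enough
    to pair them with elements of [h0]. *)
Lemma bracket_rotates u v y w :
  rotates h0 act a u y -> rotates h0 act a v w ->
  brU u v = - ipU y v *: Hl.
Proof.
move=> uy vw; have [hHl _] := Hl_dual; apply/eqP; rewrite -subr_eq0.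
set Z := _ - _; have hZ : Z \in h0.
  rewrite rpredB ?rpredZ //; apply: (centralizer_maximal_abelian br_lie h0_max).
  exact: bracket_commute uy vw.
apply/eqP/(inner_eq0 ipg_inner); rewrite {1}/Z (bilDl ipg_bil) (bilNl ipg_bil).
rewrite brUP (uy Z hZ).1 (bilNl ipU_bil) (bilZl ipU_bil) (bilZl ipg_bil).
have scaleE (c d : R) : c *: (d : R^o) = c * d by [].
by rewrite !scaleE /a (ipC ipg_inner Z); ring.
Qed.

(** Since [brU u y = - <y, y> Hl], a vanishing bracket gives [y = 0], and then
    [u] vanishes too, being proportional to [Hl y]. *)
Lemma bracket_partner_eq0 u y :
  rotates h0 act a u y -> brU u y = 0 -> u = 0.
Proof.
move=> uy; rewrite (bracket_rotates uy (rotates_turn act_bil uy)).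
move/eqP; rewrite scaler_eq0 (negPf dual_vector_neq0) orbF oppr_eq0.
move/eqP/(inner_eq0 ipU_inner) => y0; have [hHl _] := Hl_dual.
have [_ /esym/eqP] := uy Hl hHl; rewrite y0 (bil0r act_bil) scaler_eq0.
by rewrite (negPf dual_norm_neq0) => /eqP.
Qed.

Lemma real_weight_rotates u :
  real_weight_space act lambda u <-> exists y, rotates h0 act a u y.
Proof. exact: (real_weight_spaceE act_bil _ dual_imaginary). Qed.

(** Otherwise the bracket would vanish on [U_lambda], so that
    [bracket_partner_eq0] would force [U_lambda = 0], whereas the real and
    imaginary parts of a nonzero vector of weight [lambda] lie in it. *)
Lemma bracket_neq0 (B : seq U) :
  has_basis (real_weight_space act lambda) B ->
  exists u v, [/\ u \in B, v \in B & brU u v != 0].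
Proof.
move=> [_ B_span]; apply: contrapT => noB; have brU_bil := brU_bilinear.
have B0' u v : u \in B -> v \in B -> brU u v = 0.
  move=> uB vB; apply/eqP; apply: contrapT => /negP uv.
  by case: noB; exists u, v.
have in_span u y : rotates h0 act a u y -> u \in <<B>>%VS.
  move=> uy; have : real_weight_space act lambda u.
    by apply/real_weight_rotates; exists y.
  by rewrite B_span.
have zero u y : rotates h0 act a u y -> u = 0.
  move=> uy; apply: (bracket_partner_eq0 uy).
  have yu := rotates_turn act_bil uy.
  rewrite (@coord_span _ _ _ (in_tuple B) _ (in_span _ _ uy)).
  rewrite (@coord_span _ _ _ (in_tuple B) _ (in_span _ _ yu)).
  rewrite (bil_suml brU_bil) big1 // => i _.
  rewrite (bil_sumr brU_bil) big1 // => j _.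
  by rewrite (bilZl brU_bil) (bilZr brU_bil) B0' ?mem_nth // !scaler0.
case: lambda_weight => _ [[x y] xy_neq0].
move=> /(weight_spaceE act_bil _ _ dual_imaginary) xy; case/negP: xy_neq0.
by rewrite (zero _ _ xy) (zero _ _ (rotates_turn act_bil xy)).
Qed.

(** The free scalar [c] leaves room for a rational multiple of [Hl], which need
    not be rational itself. *)
Lemma n0_weight_basis (B : seq U) (c : R) :
  has_basis (real_weight_space act lambda) B -> c != 0 ->
  has_basis (n0_weight act lambda Hl) (in2 U (c *: Hl) :: map (in1 g0) B).
Proof.
move=> [B_free B_span] c_neq0.
have -> : n0_weight act lambda Hl =
    [set x | x.1 \in <<B>>%VS /\ exists d, x.2 = d *: (c *: Hl)].
  rewrite /n0_weight B_span; apply/seteqP; split=> x [x1 [d x2]]; split=> //.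
    by exists (d / c); rewrite scalerA divfK.
  by exists (d * c); rewrite -scalerA.
by apply: product_basis; rewrite // scaler_eq0 negb_or c_neq0 dual_vector_neq0.
Qed.

Lemma n0_weight_subalgebra (B : seq U) :
  has_basis (real_weight_space act lambda) B ->
  is_subalgebra bn (n0_weight act lambda Hl).
Proof.
move=> B_basis; split.
  have [_ bE] := n0_weight_basis B_basis (oner_neq0 R).
  by exists <<in2 U (1 *: Hl) :: map (in1 g0) B>>%VS.
move=> x y [/real_weight_rotates[x' xx'] _] [/real_weight_rotates[y' yy'] _].
rewrite bnE; split.
  apply/real_weight_rotates; exists 0 => K _.
  by rewrite (bil0r act_bil) scaler0 oppr0.
by exists (- ipU x' y.1); exact: bracket_rotates xx' yy'.
Qed.

Lemma rotates_lin c d u v y w : rotates h0 act a u y -> rotates h0 act a v w ->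
  rotates h0 act a (c *: u + d *: v) (c *: y + d *: w).
Proof.
move=> uy vw K hK; have [Ku Ky] := uy K hK; have [Kv Kw] := vw K hK.
rewrite !(bilDr act_bil) !(bilZr act_bil) Ku Ky Kv Kw !scalerDr !scalerN -opprD.
by rewrite !scalerA !(mulrC (a K)).
Qed.

Lemma n0_weight_geodesic nabla : is_levi_civita bn ip nabla ->
  totally_geodesic nabla (n0_weight act lambda Hl).
Proof.
have [hHl _] := Hl_dual.
move=> nabla_lc x y [/real_weight_rotates[x' xx'] [c x2]].
move=> [/real_weight_rotates[y' yy'] [d y2]]; rewrite levi_civitaE //; split=> /=.
- apply/real_weight_rotates; rewrite x2 y2 !(bilZl act_bil).
  rewrite (xx' Hl hHl).1 (yy' Hl hHl).1 scalerDr !scalerN !scaleNr !opprK !scalerA.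
  eexists.
  exact: rotates_lin (rotates_turn act_bil yy') (rotates_turn act_bil xx').
- by exists (2^-1 * - ipU x' y.1); rewrite (bracket_rotates xx' yy') scalerA.
Qed.

(** A central element commutes with the partner of its component in [U_lambda],
    so [bracket_partner_eq0] applies to that component. *)
Lemma n0_weight_center :
  has_dim (lie_center bn (n0_weight act lambda Hl)) 1.
Proof.
exists <[in2 U Hl]>%VS; split; last first.
  rewrite dim_vline; apply/eqP; rewrite eqb1; apply: contra dual_vector_neq0.
  by move/eqP/(congr1 snd) => /= ->.
apply/seteqP; split=> x /=.
- move=> [[/real_weight_rotates[y xy] [c x2]] x_central].
  have y_n0 : n0_weight act lambda Hl (y, 0).
    split; last by exists 0; rewrite scale0r.
    by apply/real_weight_rotates; exists (- x.1); exact: (rotates_turn act_bil).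
  have := congr1 snd (x_central _ y_n0); rewrite bnE /= => xy0.
  apply/vlineP; exists c; rewrite (in12E x) (bracket_partner_eq0 xy xy0) x2.
  by rewrite linear0 add0r linearZ.
- move=> /vlineP[c ->]; split.
    split; last by exists c.
    apply/real_weight_rotates; exists 0 => K _ /=.
    by rewrite !scaler0 (bil0r act_bil) oppr0.
  by move=> y _; rewrite bnE /= scaler0 (bil0l brU_bilinear).
Qed.

End Weight.

(** The inner product of [brU u v] with [Z] in [C0] is [<Z u, v>], rational since
    [Z u] is again a rational combination of [B0]. *)
Lemma brU_rational u v :
  basis_of fullv C0 ->
  (forall Z w, Z \in C0 -> Qspan B0 w -> Qspan B0 (act Z w)) ->
  u \in B0 -> v \in B0 -> Qspan C0 (brU u v).
Proof.
move=> C0_basis act_rat uB vB.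
have ip_rat x y : x \in rational_frame B0 C0 -> y \in rational_frame B0 C0 ->
    exists q : rat, ip x y = ratr q by case: ip_adm => _ _ _ _; apply.
apply: (Qspan_gram ipg_inner C0_basis) => [Y Z YC ZC | Z ZC].
  by apply: ip_rat; rewrite mem_cat map_f ?orbT.
rewrite brUP; have := act_rat Z u ZC (mem_Qspan uB).
move: (act Z u); apply: Qspan_ind => [|w w' [p wp] [q wq]|q w wB].
- by exists 0; rewrite (bil0l ipU_bil) rmorph0.
- by exists (p + q); rewrite (bilDl ipU_bil) wp wq rmorphD.
- have [p wp] : exists p : rat, ipU w v = ratr p.
    by apply: ip_rat; rewrite mem_cat map_f.
  by exists (q * p); rewrite (bilZl ipU_bil) wp rmorphM.
Qed.

End MetricNilpotent.

Theorem proposition10p2 (R : realType)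
  (g0 : vectType R) (br : g0 -> g0 -> g0)
  (br_lie : is_lie_bracket br)
  (g0_compact : forall x, x != 0 -> lie_killing br x x < 0)
  (U : vectType R) (act : g0 -> U -> U)
  (act_lie : is_lie_action br act)
  (h0 : {vspace g0})
  (h0_max : maximal_abelian br h0)
  (Delta Phi Phip : seq (hdual h0))
  (Hr X : hdual h0 -> cplx g0)
  (C : hdual h0 -> hdual h0 -> R[i])
  (C0 : seq g0)
  (C0_chevalley : compact_chevalley br Delta Phi Phip Hr X C C0)
  (B0 : seq U)
  (B0_adapted : adapted_module_basis h0 act C0 B0)
  (ip : U * g0 -> U * g0 -> R)
  (ip_adm : admissible_inner_product br act B0 C0 ip)
  (bn : U * g0 -> U * g0 -> U * g0)
  (bn_def : nilpotent_bracket act ip bn)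
  (nabla : U * g0 -> U * g0 -> U * g0)
  (nabla_lc : is_levi_civita bn ip nabla)
  (lambda : hdual h0)
  (lambda_weight : nonzero_weight act lambda)
  (Hl : g0)
  (Hl_dual : is_dual_vector ip lambda Hl)
  (lambda2 : ~ is_root br (lambda *+ 2)) :
  [/\ is_subalgebra bn (n0_weight act lambda Hl),
      totally_geodesic nabla (n0_weight act lambda Hl),
      has_dim (lie_center bn (n0_weight act lambda Hl)) 1 &
      exists b : seq (U * g0)%type,
        has_basis (n0_weight act lambda Hl) b /\
        forall x, x \in b -> Qspan (rational_frame B0 C0) x].

Proof.
have [B0_basis act_rat [Bzero [Bw [_ /(_ lambda lambda_weight) B_basis B0E]]]] :=
  B0_adapted.
split.
- exact: (n0_weight_subalgebra br_lie act_lie ip_adm bn_def h0_max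
    lambda_weight Hl_dual lambda2 B_basis).
- exact: (n0_weight_geodesic br_lie act_lie ip_adm bn_def h0_max
    lambda_weight Hl_dual lambda2 nabla_lc).
- exact: (n0_weight_center br_lie act_lie ip_adm bn_def h0_max
    lambda_weight Hl_dual lambda2).
- have BB0 u : u \in Bw lambda -> u \in B0.
    by move=> uB; apply/B0E; right; exists lambda.
  have [u [v [uB vB uv_neq0]]] := bracket_neq0 br_lie act_lie ip_adm bn_def
    h0_max lambda_weight Hl_dual lambda2 B_basis.
  have uv_rat : Qspan C0 (brU bn u v).
    apply: (brU_rational ip_adm bn_def) => //; try exact: BB0.
    exact: chev_compact_basis C0_chevalley.
  have [c uvE] : exists c, brU bn u v = c *: Hl.
    have B_rot w : w \in Bw lambda ->
        exists y, rotates h0 act (fun K => ipg ip K Hl) w y.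
      move=> wB; apply/(real_weight_rotates act_lie Hl_dual).
      by case: B_basis => _ ->; exact: memv_span.
    have [y uy] := B_rot u uB; have [w vw] := B_rot v vB.
    by exists (- ipU ip y v); rewrite (bracket_rotates br_lie act_lie ip_adm
      bn_def h0_max lambda_weight Hl_dual lambda2 uy vw).
  have c_neq0 : c != 0.
    by apply: contra uv_neq0 => /eqP c0; rewrite uvE c0 scale0r.
  exists (in2 U (c *: Hl) :: map (in1 g0) (Bw lambda)); split.
    exact: (n0_weight_basis ip_adm lambda_weight Hl_dual B_basis c_neq0).
  move=> x; rewrite inE => /orP[/eqP -> | /mapP[w /BB0 wB ->]].
  + rewrite -uvE; apply: Qspan_linear uv_rat => Z ZC.
    by rewrite mem_cat map_f ?orbT.
  + by apply: mem_Qspan; rewrite mem_cat map_f.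
Qed.
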